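(* Let $f:E\to\mathbb{R}$ be convex and differentiable with $L$-Lipschitz gradient, $L>0$, having at least one minimizer $x^*$. Let $x_0\in E$ and let $(x_n)_{n\in\mathbb{N}}$ be defined by $x_{n+1}=x_n-\frac{1}{L}\nabla f(x_n)$. Then for all $n\ge 1$, $$f(x_n)-f(x^* )\le\frac{L}{2n}\|x_0-x^*\|^2.$$
   Context: $E$ is a finite-dimensional Euclidean space with inner product $\langle\cdot,\cdot\rangle$ and associated norm $\|\cdot\|$. The gradient of $f$ is $L$-Lipschitz if $\|\nabla f(x)-\nabla f(y)\|\le L\|x-y\|$ for all $x,y\in E$. *)

(* Defs.v *)
From HB Require Import structures.
From mathcomp Require Import all_boot all_order all_algebra.
From mathcomp Require Import all_classical all_reals all_analysis.

Set Implicit Arguments.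
Unset Strict Implicit.
Unset Printing Implicit Defensive.

Import Order.TTheory GRing.Theory Num.Theory.
Import numFieldNormedType.Exports.

Local Open Scope classical_set_scope.
Local Open Scope ring_scope.

HB.structure Definition FinDimNormedModule (R : realType) :=
  {E of NormedModule R E & Vector R E}.

HB.mixin Record FinDimNormedModule_isEuclidean (R : realType) E
    of FinDimNormedModule R E := {
  inner : {dot E for @idfun R};
  euclidean_normE : forall x : E, `|x| = Num.sqrt (inner x x)
}.

#[short(type="euclideanType")]
HB.structure Definition Euclidean (R : realType) :=
  {E of FinDimNormedModule R E & FinDimNormedModule_isEuclidean R E}.

(* The gradient is the Riesz representative of the differential; [riesz] below
   guarantees that it exists, hence [inner_gradient]. *)
Definition gradient (R : realType) (E : euclideanType R) (f : E -> R^o)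
    (x : E) : E :=
  get [set g : E | forall v : E, 'd f x v = inner g v].

Lemma innerC (R : realType) (E : euclideanType R) (x y : E) :
  inner x y = inner y x.
Proof. by rewrite (hermitian_subproof (s := inner)) mul1r. Qed.

Lemma inner_eq0 (R : realType) (E : euclideanType R) (x : E) :
  inner x x = 0 -> x = 0.
Proof.
move=> xx0; apply/eqP; apply: contraPT xx0 => x0.
by apply/eqP; rewrite gt_eqF// (neq0_dnorm_gt0 (s := inner)).
Qed.

Lemma riesz (R : realType) (E : euclideanType R) (l : {linear E -> R^o}) :
  exists g : E, forall v, l v = inner g v.
Proof.
pose phi (g : E) : 'Hom(E, R^o) := linfun (inner g : E -> R^o).
have phiE g v : phi g v = inner g v by rewrite lfunE.
have phi_lin : linear phi.
  move=> a u v; apply/lfunP => w; rewrite add_lfunE scale_lfunE !phiE.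
  by rewrite linearPl.
pose Phi : {linear E -> 'Hom(E, R^o)} :=
  HB.pack phi (GRing.isLinear.Build _ _ _ _ phi phi_lin).
have ker0 : lker (linfun Phi) == 0%VS.
  apply/lker0P => u v; rewrite !lfunE/= => uv.
  apply/eqP; rewrite -subr_eq0; apply/eqP/inner_eq0.
  by rewrite linearBl/= -!phiE uv subrr.
have : linfun l \in limg (linfun Phi).
  have -> : limg (linfun Phi) = fullv.
    apply/eqP; rewrite eqEdim subvf/= limg_dim_eq; last first.
      by rewrite (eqP ker0) capv0.
    by rewrite !dimvf /dim/= muln1.
  exact: memvf.
move=> /memv_imgP[g _ lg]; exists g => v.
by rewrite -phiE; have /lfunP/(_ v) := lg; rewrite !lfunE/=.
Qed.

Lemma inner_gradient (R : realType) (E : euclideanType R) (f : E -> R^o)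
  (x v : E) : inner (gradient f x) v = 'd f x v.
Proof. by have /getPex/(_ v) -> := riesz ('d f x). Qed.

(* Main.v *)
(* Convexity bounds [f (x n) - f xstar] by [<gradient f (x n), x n - xstar>], and
   the descent lemma bounds [f (x n.+1)] by
   [f (x n) - |gradient f (x n)|^2 / (2 L)].  Added together and completed to a
   square, they give
   [f (x n.+1) - f xstar <= L/2 (|x n - xstar|^2 - |x n.+1 - xstar|^2)], which
   telescopes; since the values [f (x n)] decrease, the sum of the first [n]
   left-hand sides is at least [n (f (x n) - f xstar)]. *)
Require Import Defs.
From HB Require Import structures.
From mathcomp Require Import all_boot all_order all_algebra.
From mathcomp Require Import all_classical all_reals all_analysis.
From mathcomp Require Import ring lra.

Set Implicit Arguments.
Unset Strict Implicit.
Unset Printing Implicit Defensive.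

Import Order.TTheory GRing.Theory Num.Theory.
Import numFieldNormedType.Exports.

Local Open Scope classical_set_scope.
Local Open Scope ring_scope.

Lemma sqr_normE (R : realType) (E : euclideanType R) (x : E) :
  `|x| ^+ 2 = inner x x.
Proof.
rewrite euclidean_normE sqr_sqrtr//.
have [->|x0] := eqVneq x 0; first by rewrite linear0r.
by rewrite ltW// (neq0_dnorm_gt0 (s := inner)).
Qed.

Lemma sqr_normB (R : realType) (E : euclideanType R) (x y : E) :
  `|x - y| ^+ 2 = `|x| ^+ 2 - 2 * inner x y + `|y| ^+ 2.
Proof.
rewrite !sqr_normE linearBl/= !linearBr/= (innerC y x).
ring.
Qed.

Lemma innerZr (R : realType) (E : euclideanType R) (a : R) (x y : E) :
  inner x (a *: y) = a * inner x y.
Proof. by rewrite linearZr. Qed.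

(* Expanding [0 <= `|u - c *: v| ^+ 2] avoids the Cauchy-Schwarz inequality. *)
Lemma inner_le_of_norm_le (R : realType) (E : euclideanType R) (c : R) (u v : E) :
  0 < c -> `|u| <= c * `|v| -> inner u v <= c * `|v| ^+ 2.
Proof.
move=> c0 uv; have := sqr_ge0 `|u - c *: v|.
rewrite sqr_normB innerZr normrZ gtr0_norm// => h.
have u2 : `|u| ^+ 2 <= (c * `|v|) ^+ 2 by rewrite lerXn2r ?nnegrE// mulr_ge0// ltW.
rewrite -(ler_pM2l c0); rewrite exprMn in h u2; lra.
Qed.

(** Restricting [f] to a line makes one-variable calculus available. The difference quotients in [t]
    are literally those of [f] at [x + t *: v] along [v], so derivability and the limit carry over
    without a chain rule. *)
Lemma is_derive_line (R : realType) (E : euclideanType R) (f : E -> R^o)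
    (x v : E) (t : R) :
  differentiable f (x + t *: v) ->
  is_derive t 1 (fun s : R => f (x + s *: v) : R)
    (inner (gradient f (x + t *: v)) v).
Proof.
move=> df; rewrite inner_gradient -deriveE//.
have quotE : (fun h : R => h^-1 *: (f (x + (h *: (1 : R) + t) *: v)
                                     - f (x + t *: v))) =
    (fun h : R => h^-1 *: (f (h *: v + (x + t *: v)) - f (x + t *: v))).
  by apply/funext => h; rewrite [h *: 1]mulr1 scalerDl addrCA.
apply: DeriveDef.
  by have := diff_derivable (v := v) df; rewrite /derivable -quotE.
exact: (congr1 (fun q : R -> R^o => lim (q @ 0^')) quotE).
Qed.

(** By convexity, the difference quotient of [f] at [x] along [y - x] with step [h] in (0, 1] is at
    most [f y - f x]; let [h] tend to 0 from the right. *)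
Lemma convex_gradient_le (R : realType) (E : euclideanType R) (f : E -> R^o)
    (x y : E) :
  convex_function [set: E] f -> differentiable f x ->
  f x + inner (gradient f x) (y - x) <= f y.
Proof.
move=> cf df; rewrite addrC -lerBrDr inner_gradient -deriveE//.
apply: (cvgr_to_le (cvg_dnbhs_at_right (diff_derivable (v := y - x) df))).
near=> h.
have h0 : 0 < h by near: h; exact: nbhs_right_gt.
have h1 : h <= 1 by near: h; exact: nbhs_right_le.
have cfh : f (h *: y + (1 - h) *: x) <= h * f y + (1 - h) * f x.
  exact: cf (Itv01 (ltW h0) h1) y x (in_setT _) (in_setT _).
rewrite scalerBl scale1r addrCA -scalerBr addrC in cfh.
rewrite -[h^-1 *: _]/(h^-1 * _) ler_pdivrMl//.
rewrite lerBlDr; apply: (le_trans cfh).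
by rewrite mulrBr mulrBl mul1r addrA addrAC.
Unshelve. all: by end_near. Qed.

(** Monotonicity replaces integration of the gradient: [psi], which is [f] along the segment minus
    [a * t + b * t ^+ 2], has nonpositive derivative on ]0, 1[, and the claim is
    [psi 1 <= psi 0]. *)
Lemma descent_lemma (R : realType) (E : euclideanType R) (f : E -> R^o) (L : R)
    (x y : E) :
  0 < L -> (forall z, differentiable f z) -> L.-lipschitz (gradient f) ->
  f y <= f x + inner (gradient f x) (y - x) + L / 2 * `|y - x| ^+ 2.
Proof.
move=> L0 df lipf; set v := y - x.
pose a := inner (gradient f x) v; pose b := L / 2 * `|v| ^+ 2.
pose psi : R -> R := (fun t : R => f (x + t *: v) : R)
  - (a \*: id + b \*: ((@id R) ^+ 2)).
have dpsi (t : R) : is_derive t 1 psi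
    (inner (gradient f (x + t *: v)) v - (a + 2 * t * b)).
  have dl := is_derive_line (df (x + t *: v)).
  apply: is_derive_eq.
  by rewrite /= !/(_ *: _)/=; ring.
have dpsi_le0 (t : R) : t \in `]0, 1[ -> derive1 psi t <= 0.
  rewrite in_itv/= => /andP[t0 _]; rewrite derive1E derive_val.
  (* Here [c = L * t], positive since [0 < t], and [c * |v|^2] equals [2 * t * b], the derivative of
     the quadratic term. *)
  have /inner_le_of_norm_le : `|gradient f (x + t *: v) - gradient f x|
      <= L * t * `|v|.
    have := lipf (x + t *: v, x) (conj I I).
    by rewrite /= (addrC x) addrK normrZ gtr0_norm// mulrA.
  by rewrite mulr_gt0// linearBl/= -/a /b => /(_ isT); lra.
have psi10 : psi 1 <= psi 0.
  apply: (@ler0_derive1_le_cc _ _ 0 1) => //.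
  - apply: continuous_subspaceT => t.
    by apply/differentiable_continuous/derivable1_diffP; exact: ex_derive.
  - by rewrite in_itv/= lexx ler01.
  - by rewrite in_itv/= lexx ler01.
have psiE t : psi t = f (x + t *: v) - (a * t + b * t ^+ 2) by [].
move: psi10; rewrite !psiE scale0r addr0 scale1r [x + v]addrC subrK.
by rewrite expr0n expr1n !mulr0 !mulr1 addr0 subr0 lerBlDr addrA.
Qed.

(** The step [L^-1] minimizes the quadratic bound of [descent_lemma]: the linear term gives
    [-|g|^2 / L], the quadratic one [|g|^2 / (2 L)], with [g] the gradient at [x]. *)
Lemma gradient_step_decrease (R : realType) (E : euclideanType R) (f : E -> R^o)
    (L : R) (x : E) :
  0 < L -> (forall z, differentiable f z) -> L.-lipschitz (gradient f) ->
  f (x - L^-1 *: gradient f x) <= f x - (2 * L)^-1 * `|gradient f x| ^+ 2.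
Proof.
move=> L0 df lipf.
have /le_trans := descent_lemma x (x - L^-1 *: gradient f x) L0 df lipf; apply.
rewrite [_ - _ - x]addrAC subrr sub0r normrN linearNr/= innerZr normrZ.
rewrite -sqr_normE exprMn gtr0_norm ?invr_gt0//.
rewrite le_eqVlt; apply/orP; left; apply/eqP; field.
by rewrite gt_eqF.
Qed.

Lemma gradient_step_telescope (R : realType) (E : euclideanType R)
    (f : E -> R^o) (L : R) (x z : E) :
  0 < L -> convex_function [set: E] f -> (forall y, differentiable f y) ->
  L.-lipschitz (gradient f) ->
  f (x - L^-1 *: gradient f x) - f z <=
    L / 2 * (`|x - z| ^+ 2 - `|x - L^-1 *: gradient f x - z| ^+ 2).
Proof.
move=> L0 cf df lipf.
have dec := gradient_step_decrease x L0 df lipf.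
have cvx := convex_gradient_le z cf (df x).
set g := gradient f x in dec cvx *.
have -> : x - L^-1 *: g - z = (x - z) - L^-1 *: g by rewrite addrAC.
rewrite (sqr_normB (x - z)) innerZr normrZ exprMn gtr0_norm ?invr_gt0//.
have -> : inner (x - z) g = - inner g (z - x).
  by rewrite innerC -opprB linearNr.
(* The expanded right-hand side is exactly the bound obtained by adding [dec] and [cvx]. *)
have -> : L / 2 * (`|x - z| ^+ 2 - (`|x - z| ^+ 2
    - 2 * (L^-1 * - inner g (z - x)) + L^-1 ^+ 2 * `|g| ^+ 2))
  = - inner g (z - x) - (2 * L)^-1 * `|g| ^+ 2 by field; rewrite gt_eqF.
lra.
Qed.

Theorem theorem2 (R : realType) (E : euclideanType R) (f : E -> R^o) (L : R)
    (hL : 0 < L)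
    (hconv : convex_function [set: E] f)
    (hdiff : forall y : E, differentiable f y)
    (hlip : L.-lipschitz (gradient f))
    (xstar : E) (hmin : forall y : E, f xstar <= f y)
    (x0 : E) (x : nat -> E) (hx0 : x 0%N = x0)
    (hx : forall n : nat, x n.+1 = x n - L^-1 *: gradient f (x n)) :
  forall n : nat, (1 <= n)%N ->
    f (x n) - f xstar <= L / (2 * n%:R) * `|x0 - xstar| ^+ 2.
Proof.
have dec n : f (x n.+1) <= f (x n).
  rewrite hx; apply: (le_trans (gradient_step_decrease (x n) hL hdiff hlip)).
  by rewrite gerBl mulr_ge0 ?sqr_ge0// invr_ge0 mulr_ge0// ltW.
(* Keeping the term in [x n] on the right lets the next step cancel it. *)
have telescope n : n%:R * (f (x n) - f xstar) <=
    L / 2 * (`|x0 - xstar| ^+ 2 - `|x n - xstar| ^+ 2).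
  elim: n => [|n IHn]; first by rewrite hx0 mul0r subrr mulr0.
  have step := gradient_step_telescope (x n) xstar hL hconv hdiff hlip.
  rewrite -hx in step.
  (* Monotonicity moves the [n] copies of the gap from [x n] to [x n.+1]; [step] supplies one
     more. *)
  have := ler_wpM2l (ler0n R n) (lerB (dec n) (lexx (f xstar))).
  rewrite -natr1; lra.
move=> n n1; have n0 : 0 < n%:R :> R by rewrite ltr0n.
rewrite -(ler_pM2l n0); apply: (le_trans (telescope n)).
have -> : n%:R * (L / (2 * n%:R) * `|x0 - xstar| ^+ 2) =
  L / 2 * `|x0 - xstar| ^+ 2 by field; rewrite gt_eqF.
by rewrite ler_pM2l ?divr_gt0// gerBl sqr_ge0.
Qed.
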